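(* Let $\rho\in(0,\rho_0)$ with $\rho_0:=0.779$. Consider the infinite linear system in the unknowns $x_1,x_2,x_3,\ldots$ $$x_1\,\frac{1+\rho-\rho^2}{1+\rho}+\sum_{j=2}^\infty(-1)^jx_j\,\frac{\rho^2}{j(j+\rho)}=\frac{\rho^2}{1+\rho},$$ $$x_i\left(\rho^{-i/2}+(-1)^i\frac{\rho^{i/2}}{i^i}\right)-x_1\rho^{i/2}+\sum_{j\ge 2,\ j\neq i}(-1)^jx_j\left(\frac{\rho^{1/2}}{j}\right)^i=\rho^{i/2},\qquad i=2,3,\ldots.$$ Then this system has a unique bounded solution $(x_j)_{j\ge1}$. Moreover, for every $N\geq 1$ the truncated $N\times N$ system, obtained by keeping only the first $N$ equations and the first $N$ unknowns, has a unique solution $(x_1^N,\ldots,x_N^N)$, and for each fixed $j$ the sequence $(x_j^N)_{N\ge j}$ is Cauchy and converges to $x_j$ as $N\to\infty$.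
   Context: This system arises in the light traffic analysis of the gated $M/M/\infty$ queue with arrival rate $\lambda$, service rate $\mu$ and $\rho=\lambda/\mu$: it is the recast form of the system $\rho^{-i}y_i=1+\sum_{j\ge2}(-1)^jy_j(1-j^{-i})$, $i=2,3,\ldots$, with $x_i=y_i$ for $i\ge2$ and $x_1=\sum_{j\ge2}(-1)^jy_j$. The statement itself concerns only the displayed linear system. *)

(* Defs.v *)
From HB Require Import structures.
From mathcomp Require Import all_boot all_order all_algebra.
From mathcomp Require Import all_classical all_reals all_analysis.
Set Implicit Arguments.
Unset Strict Implicit.
Unset Printing Implicit Defensive.
Import Order.TTheory GRing.Theory Num.Theory.
Import numFieldNormedType.Exports.
Local Open Scope classical_set_scope.
Local Open Scope ring_scope.

(* Coefficient of the unknown x_j in the i-th equation; i and j are the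
   1-based indices of the system, and the value at an index 0 is irrelevant. *)
Definition coef (R : realType) (rho : R) (i j : nat) : R :=
  if i == 1%N then
    if j == 1%N then (1 + rho - rho ^+ 2) / (1 + rho)
    else (-1) ^+ j * (rho ^+ 2 / (j%:R * (j%:R + rho)))
  else if j == 1%N then - rho `^ (i%:R / 2)
  else if j == i then
    rho `^ (- (i%:R / 2)) + (-1) ^+ i * (rho `^ (i%:R / 2) / i%:R ^+ i)
  else (-1) ^+ j * (rho `^ (1 / 2) / j%:R) ^+ i.

Definition rhs (R : realType) (rho : R) (i : nat) : R :=
  if i == 1%N then rho ^+ 2 / (1 + rho) else rho `^ (i%:R / 2).

(* The unknowns x_1, x_2, ... are stored from index 0: x k is x_(k+1).
   Convergence of the series in every equation is part of being a solution. *)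
Definition solution (R : realType) (rho : R) (x : nat -> R) : Prop :=
  forall i : nat,
    series (fun k => coef rho i.+1 k.+1 * x k) @ \oo --> rhs rho i.+1.

Definition bounded_solution (R : realType) (rho : R) (x : nat -> R) : Prop :=
  bounded_fun x /\ solution rho x.

Definition truncated_solution (R : realType) (rho : R) (N : nat)
    (v : 'cV[R]_N) : Prop :=
  (\matrix_(i < N, j < N) coef rho i.+1 j.+1) *m v
    = \col_(i < N) rhs rho i.+1.

(* For a family of vectors xN N = (x_1^N, ..., x_N^N), the sequence
   (x_j^N)_(N >= j) with j = k + 1; its n-th term is the one for N = k + n.+1,
   whose entry [rshift k ord0] has 0-based index k. *)
Definition component (R : realType) (xN : forall N : nat, 'cV[R]_N) (k : nat)
    : nat -> R :=
  fun n => xN (k + n.+1)%N (rshift k (@ord0 n)) 0.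

(* Main.v *)
Require Import Defs.
From HB Require Import structures.
From mathcomp Require Import all_boot all_order all_algebra.
From mathcomp Require Import all_classical all_reals all_analysis.
From mathcomp Require Import ring lra.
Set Implicit Arguments.
Unset Strict Implicit.
Unset Printing Implicit Defensive.
Import Order.TTheory GRing.Theory Num.Theory.
Import numFieldNormedType.Exports.
Local Open Scope classical_set_scope.
Local Open Scope ring_scope.

(** The infinite matrix is strictly diagonally dominant by rows with the uniform
    margin 1/20, and its rows beyond column m have l^1-norm at most 1/m as soon
    as m is at least the row index.  Dominance bounds a vector by its image in
    the sup norm, for every truncation and with the same constant, so every
    truncated system is invertible with solutions bounded independently of N.
    Any bounded sequence satisfying the first N equations, exactly or after
    cutting the sums at some P >= N, satisfies the truncated ones up to O(1/N),
    hence is O(1/N)-close to x^N in its first N entries.  Applied to x^P this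
    makes the components Cauchy; applied to an arbitrary bounded solution it
    gives uniqueness and convergence. *)

(** * Infinite diagonally dominant matrices and their truncations *)

Definition uniformly_dominant (R : realType) (a : nat -> nat -> R) (delta : R) :=
  forall i N : nat, (i < N)%N ->
    delta + \sum_(0 <= j < N | j != i) `|a i j| <= `|a i i|.

(** The bound depends on the cut [m] alone and not on the row, so cutting at [m] perturbs all of the
    first [m] equations by the same small amount in the sup norm. *)
Definition tails_bounded_by (R : realType) (a : nat -> nat -> R) (t : nat -> R) :=
  forall i m n : nat, (i < m)%N -> \sum_(m <= j < n) `|a i j| <= t m.

Definition solves_truncation (R : realType) (a : nat -> nat -> R)
    (b : nat -> R) (N : nat) (u : nat -> R) :=
  forall i : nat, (i < N)%N -> \sum_(0 <= j < N) a i j * u j = b i.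

(** Solutions of truncations of different sizes live in different types; as sequences they can be
    subtracted and passed to the limit. *)
Definition extend_by_zero (R : realType) (N : nat) (v : 'cV[R]_N) : nat -> R :=
  fun j => oapp (fun i : 'I_N => v i 0) 0 (insub j).

Lemma extend_by_zeroE (R : realType) (N : nat) (v : 'cV[R]_N) (i : 'I_N) :
  extend_by_zero v i = v i 0.
Proof. by rewrite /extend_by_zero valK. Qed.

(** At an index [k] where [|u k|] is largest, the off-diagonal terms of row [k] cannot exceed their
    coefficient sum times [|u k|], so the row is at least [delta * |u k|] in absolute value. *)
Lemma dominant_stable (R : realType) (a : nat -> nat -> R) (delta : R)
    (N : nat) (u : nat -> R) (c : R) :
  0 < delta -> uniformly_dominant a delta ->
  (forall i : nat, (i < N)%N -> `|\sum_(0 <= j < N) a i j * u j| <= c) ->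
  forall i : nat, (i < N)%N -> `|u i| <= c / delta.
Proof.
move=> d0 dom hc i iN.
have [k _ kmax] := @arg_maxP _ _ _ (Ordinal iN) predT
  (fun k : 'I_N => `|u k|) isT.
apply: le_trans (kmax (Ordinal iN) isT) _.
rewrite ler_pdivlMr //; apply: le_trans (hc k (ltn_ord k)).
have kr : (k : nat) \in index_iota 0 N by rewrite mem_index_iota /=.
rewrite (bigD1_seq (k : nat)) ?iota_uniq //=.
set S := \sum_(0 <= j < N | j != k) a k j * u j.
have hS : `|S| <= (\sum_(0 <= j < N | j != k) `|a k j|) * `|u k|.
  apply: le_trans (ler_norm_sum _ _ _) _.
  rewrite mulr_suml big_seq_cond [leRHS]big_seq_cond; apply: ler_sum => j.
  rewrite mem_index_iota => /andP[/= jN _].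
  by rewrite normrM ler_wpM2l //; exact: (kmax (Ordinal jN) isT).
have hk := ler_wpM2r (normr_ge0 (u k)) (dom k N (ltn_ord k)).
have h := lerB_normD (a k k * u k) S.
apply: le_trans h; rewrite normrM; lra.
Qed.

(** Stability with [c = 0] kills the kernel. The transpose appears because [kermx] collects row
    vectors acting from the left. *)
Lemma dominant_unitmx (R : realType) (a : nat -> nat -> R) (delta : R)
    (N : nat) :
  0 < delta -> uniformly_dominant a delta ->
  (\matrix_(i < N, j < N) a i j) \in unitmx.
Proof.
move=> d0 dom; rewrite -unitmx_tr -row_free_unit -kermx_eq0.
apply/eqP; apply/row_matrixP => l; rewrite row0; apply/rowP => k.
rewrite [RHS]mxE; set r := row l _.
have hr : r *m (\matrix_(i < N, j < N) a i j)^T = 0.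
  by apply/sub_kermxP; exact: row_sub.
have hi := @dominant_stable R a delta N (extend_by_zero r^T) 0 d0 dom.
suff : `|extend_by_zero r^T k| <= 0 / delta.
  by rewrite mul0r normr_le0 extend_by_zeroE [_^T _ _]mxE => /eqP.
apply: hi => // i iN.
rewrite big_mkord.
have /rowP/(_ (Ordinal iN)) := hr; rewrite !mxE => h.
rewrite (_ : \sum_(_ < N) _ = 0) ?normr0 // -[RHS]h.
apply: eq_bigr => j _; rewrite extend_by_zeroE [r^T _ _]mxE mulrC.
by congr (_ * _); rewrite !mxE.
Qed.

Lemma truncated_mxP (R : realType) (a : nat -> nat -> R) (b : nat -> R)
    (N : nat) (v : 'cV[R]_N) :
  (\matrix_(i < N, j < N) a i j) *m v = \col_(i < N) b i <->
  solves_truncation a b N (extend_by_zero v).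
Proof.
have E (i : 'I_N) : \sum_(0 <= j < N) a i j * extend_by_zero v j =
    ((\matrix_(i < N, j < N) a i j) *m v) i 0.
  rewrite big_mkord mxE; apply: eq_bigr => j _.
  by rewrite extend_by_zeroE !mxE.
split=> [h i iN|h].
  by rewrite (E (Ordinal iN)) h mxE.
by apply/colP => i; rewrite -E h // mxE.
Qed.

(** * Tail estimates and passage to the limit in the truncation size *)

Lemma tail_bound (R : realType) (a : nat -> nat -> R) (t : nat -> R)
    (y : nat -> R) (M : R) (i m n : nat) :
  0 <= M -> tails_bounded_by a t -> (forall j, `|y j| <= M) -> (i < m)%N ->
  `|\sum_(m <= j < n) a i j * y j| <= M * t m.
Proof.
move=> M0 ht hy im; apply: le_trans (ler_norm_sum _ _ _) _.
apply: (@le_trans _ _ (M * \sum_(m <= j < n) `|a i j|)).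
  rewrite mulr_sumr; apply: ler_sum => j _.
  by rewrite normrM mulrC ler_wpM2r.
by rewrite ler_wpM2l // ht.
Qed.

Lemma limit_dist_le (R : realType) (u : nat -> R) (l z c : R) (n : nat) :
  u @ \oo --> l -> (forall p, (n <= p)%N -> `|u p - z| <= c) -> `|l - z| <= c.
Proof.
move=> ul h.
have hl : `|u p - z| @[p --> \oo] --> `|l - z|.
  by apply: cvg_norm; apply: cvgB => //; exact: cvg_cst.
rewrite -(cvg_lim _ hl) //; apply: limr_le; first by apply/cvg_ex; eexists; exact: hl.
by near=> p; apply: h; near: p; exact: nbhs_infty_ge.
Unshelve. all: by end_near. Qed.

Lemma cvg_of_dist_le (R : realType) (u t : nat -> R) (l C : R) (k : nat) :
  t @ \oo --> 0 -> (forall n, (k < n)%N -> `|l - u n| <= C * t n) ->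
  u @ \oo --> l.
Proof.
move=> t0 h.
have hC : C * t n @[n --> \oo] --> 0.
  by rewrite -(mulr0 C); apply: cvgM => //; exact: cvg_cst.
apply/cvgrPdist_le => e e0.
have /cvgr0_norm_le/(_ e e0) := hC; apply: filterS2 (nbhs_infty_gt k) => n kn hn.
exact: le_trans (h n kn) (le_trans (ler_norm _) hn).
Qed.

Lemma dominant_system (R : realType) (a : nat -> nat -> R) (b t : nat -> R)
    (delta B : R) :
  0 < delta -> uniformly_dominant a delta -> tails_bounded_by a t ->
  t @ \oo --> 0 -> (forall i, `|b i| <= B) ->
  exists x : nat -> R,
    [/\ exists M : R, forall j, `|x j| <= M,
        forall i, series (fun j => a i j * x j) @ \oo --> b i,
        forall (y : nat -> R) (M : R), (forall j, `|y j| <= M) ->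
          (forall i, series (fun j => a i j * y j) @ \oo --> b i) -> y = x
      & forall u : nat -> nat -> R,
          (forall N, (1 <= N)%N -> solves_truncation a b N (u N)) ->
          forall k, u N k @[N --> \oo] --> x k].
Proof.
move=> d0 dom ht t0 hb.
pose A N : 'M[R]_N := \matrix_(i < N, j < N) a i j.
pose u N := extend_by_zero (invmx (A N) *m \col_(i < N) b i).
have hu N : solves_truncation a b N (u N).
  by apply/truncated_mxP; rewrite mulKVmx // (dominant_unitmx _ d0).
have B0 : 0 <= B by apply: le_trans (hb 0%N).
pose M := B / delta.
have M0 : 0 <= M by rewrite divr_ge0 // ltW.
(* Beyond [N] the extension is zero, so one bound serves all [N] and [j]. *)
have uM N j : `|u N j| <= M.
  have [jN|jN] := ltnP j N.
    by apply: (dominant_stable (N := N) d0 dom _ jN) => i iN; rewrite hu.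
  by rewrite /u /extend_by_zero insubF ?normr0 // ltnNge jN.
have near_trunc N (v y : nat -> R) c : solves_truncation a b N v ->
    (forall i, (i < N)%N -> `|\sum_(0 <= j < N) a i j * y j - b i| <= c) ->
    forall i, (i < N)%N -> `|y i - v i| <= c / delta.
  move=> hv hc; apply: (@dominant_stable R a delta N (fun j => y j - v j) c d0 dom).
  move=> i iN; apply: le_trans (hc i iN); rewrite -(hv i iN) -sumrB.
  by under eq_bigr do rewrite mulrBr.
pose C := M / delta.
(* [u P] solves row [i < N] over [P] columns, so over the first [N] columns its residual is, up to
   sign, the tail from [N] to [P], of size at most [M * t N]. *)
have u_dist N P k : (k < N)%N -> (N <= P)%N -> `|u P k - u N k| <= C * t N.
  move=> kN NP; rewrite /C mulrAC; apply: (near_trunc N) => // i iN.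
  rewrite -(hu P i (leq_trans iN NP)) (@big_cat_nat _ _ _ N 0 P) //=.
  by rewrite opprD addrA subrr sub0r normrN; exact: tail_bound.
have u_cvg k : cvg (u n k @[n --> \oo]).
  apply/cauchy_cvgP; apply: cauchy_exP => e e0.
  have hC : C * t n @[n --> \oo] --> 0.
    by rewrite -(mulr0 C); apply: cvgM => //; exact: cvg_cst.
  have /cvgr0_norm_lt/(_ e e0)[m _ hm] := hC.
  pose N := maxn m k.+1; exists (u N k), N => // P /= NP.
  rewrite /ball /= distrC; apply: le_lt_trans (u_dist N P k _ NP) _.
    by rewrite leq_maxr.
  by apply: le_lt_trans (ler_norm _) (hm _ _); rewrite /= leq_maxl.
pose x k := limn (fun n => u n k).
have x_dist N k : (k < N)%N -> `|x k - u N k| <= C * t N.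
  by move=> kN; apply: (limit_dist_le (n := N) (u_cvg k)) => P NP; exact: u_dist.
have xM j : `|x j| <= M.
  rewrite -[x j]subr0; apply: (limit_dist_le (n := 0%N) (u_cvg j)) => P _.
  by rewrite subr0.
(* The same comparison with [P] sent to infinity, for any bounded solution [y]; uniqueness will
   follow since [y] and [x] are both limits of [u]. *)
have all_cvg (v : nat -> nat -> R) (y : nat -> R) K :
    (forall N, (1 <= N)%N -> solves_truncation a b N (v N)) ->
    (forall j, `|y j| <= K) ->
    (forall i, series (fun j => a i j * y j) @ \oo --> b i) ->
    forall k, v N k @[N --> \oo] --> y k.
  move=> hv hy ys k; have K0 : 0 <= K by apply: le_trans (hy 0%N).
  apply: (@cvg_of_dist_le R _ t _ (K / delta) k) => // N kN.
  rewrite mulrAC; apply: (near_trunc N) => //.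
    by apply: hv; apply: leq_ltn_trans kN.
  move=> i iN; rewrite distrC; apply: (limit_dist_le (n := N) (ys i)) => P NP.
  rewrite /series /= (@big_cat_nat _ _ _ N 0 P) //= addrAC subrr add0r.
  exact: tail_bound.
have x_sol i : series (fun j => a i j * x j) @ \oo --> b i.
  (* [D] dominates every partial l^1-norm of row [i], and the first [n] entries of [x] and [u n]
     differ by at most [C * t n]. *)
  pose D := \sum_(0 <= j < i.+1) `|a i j| + t i.+1.
  apply: (@cvg_of_dist_le R _ t _ (D * C) i) => // n ni.
  rewrite distrC -(hu n i ni) /series /= -sumrB.
  apply: le_trans (ler_norm_sum _ _ _) _.
  have tn0 : 0 <= C * t n by apply: le_trans (x_dist n i ni).
  apply: (@le_trans _ _ ((\sum_(0 <= j < n) `|a i j|) * (C * t n))).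
    rewrite mulr_suml big_seq_cond [leRHS]big_seq_cond; apply: ler_sum => j.
    rewrite mem_index_iota => /andP[/= jn _].
    by rewrite -mulrBr normrM ler_wpM2l // x_dist.
  rewrite -[leRHS]mulrA ler_wpM2r // (@big_cat_nat _ _ _ i.+1 0 n) //= lerD2l.
  exact: ht.
exists x; split=> //; first by exists M.
  move=> y K hy ys; apply/funext => k.
  have h1 := all_cvg u y K (fun N _ => hu N) hy ys k.
  have h2 := all_cvg u x M (fun N _ => hu N) xM x_sol k.
  exact: (cvg_unique _ h1 h2).
by move=> v hv; exact: (all_cvg v x M hv xM x_sol).
Qed.

(** * Estimates on the coefficients of the given system *)

Lemma sum_inv_sq_le (R : realType) (m n : nat) : (0 < m)%N ->
  \sum_(m <= j < n) (j.+1%:R ^+ 2)^-1 <= m%:R^-1 :> R.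
Proof.
move=> m0; have [nm|mn] := leqP n m; first by rewrite big_geq // invr_ge0.
suff : \sum_(m <= j < n) (j.+1%:R ^+ 2)^-1 <= m%:R^-1 - n%:R^-1 :> R.
  by move/le_trans; apply; rewrite gerBl invr_ge0.
(* Telescoping: 1/(j+1)^2 is at most 1/j - 1/(j+1). *)
rewrite -opprB -(telescope_sumr (fun j => j%:R^-1 : R) (ltnW mn)) -sumrN.
rewrite big_seq_cond [leRHS]big_seq_cond; apply: ler_sum => j.
rewrite mem_index_iota => /andP[/andP[mj _] _].
have j0 : 0 < j%:R :> R by rewrite ltr0n (leq_trans m0).
rewrite opprB -natr1.
have -> : j%:R^-1 - (j%:R + 1)^-1 = (j%:R * (j%:R + 1))^-1 :> R.
  by field; rewrite !lt0r_neq0 //; lra.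
rewrite lef_pV2 ?posrE; nra.
Qed.

Lemma sqrt_pow_bounds (R : realType) (rho : R) (i : nat) :
  0 < rho -> rho <= 1 -> (2 <= i)%N -> 0 < rho `^ (i%:R / 2) <= rho.
Proof.
move=> r0 r1 i2; rewrite powR_gt0 //=.
rewrite -{2}(powRr1 (ltW r0)); apply: ger_powR; first by rewrite r0.
have : 2 <= i%:R :> R by rewrite ler_nat.
by move=> ?; lra.
Qed.

(** The first column has its own sign and form, but 1^i = 1 makes its absolute value fit the common
    formula. *)
Lemma norm_coef_offdiag (R : realType) (rho : R) (i j : nat) :
  0 < rho -> (2 <= i)%N -> (0 < j)%N -> j != i ->
  `|coef rho i j| = rho `^ (i%:R / 2) * (j%:R ^+ i)^-1.
Proof.
move=> r0 i2 j0 ji; rewrite /coef gtn_eqF // (negbTE ji).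
case: ifPn => [/eqP->|_].
  by rewrite normrN expr1n invr1 mulr1 ger0_norm // powR_ge0.
rewrite normrM normrX normrN1 expr1n mul1r ger0_norm; last first.
  by rewrite exprn_ge0 // divr_ge0 // powR_ge0.
rewrite expr_div_n -powR_mulrn ?powR_ge0 // -powRrM.
by rewrite mul1r [2^-1 * _]mulrC.
Qed.

Lemma coef_tails (R : realType) (rho : R) : 0 < rho -> rho <= 1 ->
  tails_bounded_by (fun i j => coef rho i.+1 j.+1) (fun m => m%:R^-1).
Proof.
move=> r0 r1 i m n im; have m0 : (0 < m)%N by case: m im.
apply: le_trans (sum_inv_sq_le R n m0).
rewrite big_seq_cond [leRHS]big_seq_cond; apply: ler_sum => j.
rewrite mem_index_iota => /andP[/andP[mj _] _].
have ij : (i < j)%N by apply: leq_trans mj.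
have j1 : 1 < j.+1%:R :> R by rewrite ltr1n ltnS (leq_ltn_trans _ ij).
case: i im ij => [|i] im ij.
  rewrite /coef /= eqSS gtn_eqF // normrM normrX normrN1 expr1n mul1r.
  rewrite ger0_norm; last by rewrite divr_ge0 ?exprn_ge0 ?mulr_ge0 //; lra.
  rewrite ler_pdivrMr; last by rewrite mulr_gt0; lra.
  rewrite mulrC ler_pdivlMr; last by rewrite exprn_gt0; lra.
  have rsq : rho ^+ 2 <= 1 by rewrite expr_le1 // ltW.
  have : rho ^+ 2 * j.+1%:R ^+ 2 <= j.+1%:R ^+ 2.
    by rewrite ler_piMl // exprn_ge0 //; lra.
  nra.
have /andP[p0 p1] := @sqrt_pow_bounds R rho i.+2 r0 r1 isT.
rewrite norm_coef_offdiag // ?eqSS ?gtn_eqF //.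
apply: (@le_trans _ _ ((j.+1%:R ^+ i.+2)^-1)).
  by rewrite ler_piMl ?invr_ge0 ?exprn_ge0 //; lra.
rewrite lef_pV2 ?posrE ?exprn_gt0 //; try lra.
by rewrite ler_eXn2l.
Qed.

Lemma norm_rhs_le1 (R : realType) (rho : R) (i : nat) :
  0 < rho -> rho <= 1 -> `|rhs rho i.+1| <= 1.
Proof.
move=> r0 r1; rewrite /rhs; case: i => [|i] /=.
  rewrite ger0_norm; last by rewrite divr_ge0 ?exprn_ge0 //; lra.
  rewrite ler_pdivrMr; last by lra.
  nra.
have /andP[p0 p1] := @sqrt_pow_bounds R rho i.+2 r0 r1 isT.
by rewrite ger0_norm; lra.
Qed.

(** The off-diagonal sum is at most [rho ^+ 2] and the diagonal is 1 - rho^2/(1+rho). At rho = 0.779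
    the difference is about 0.052, just enough for the margin 1/20. *)
Lemma coef_row1_dominant (R : realType) (rho : R) (N : nat) :
  0 < rho -> rho < 779%:R / 1000%:R -> (0 < N)%N ->
  1 / 20%:R + \sum_(0 <= j < N | j != 0%N) `|coef rho 1 j.+1|
    <= `|coef rho 1 1|.
Proof.
move=> r0 r1 N0.
have : \sum_(0 <= j < N | j != 0%N) `|coef rho 1 j.+1| <= rho ^+ 2 * 1%:R^-1.
  rewrite big_mkcond big_ltn //= add0r.
  apply: le_trans (_ : rho ^+ 2 * \sum_(1 <= j < N) (j.+1%:R ^+ 2)^-1 <= _);
    last by rewrite ler_pM2l ?exprn_gt0 //; exact: sum_inv_sq_le.
  rewrite mulr_sumr; apply: ler_sum => -[|j] _ /=.
    by rewrite mulr_ge0 ?invr_ge0 ?exprn_ge0 //; lra.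
  rewrite /coef /= normrM normrX normrN1 expr1n mul1r.
  have j0 : 0 < j.+2%:R :> R by rewrite ltr0n.
  rewrite ger0_norm; last by rewrite divr_ge0 ?exprn_ge0 ?mulr_ge0 //; lra.
  rewrite ler_pM2l ?exprn_gt0 // lef_pV2 ?posrE; nra.
have -> : coef rho 1 1 = 1 - rho ^+ 2 / (1 + rho).
  by rewrite /coef /=; field; lra.
have : rho ^+ 2 / (1 + rho) <= 95%:R / 100%:R - rho ^+ 2.
  rewrite ler_pdivrMr; last by lra.
  nra.
move=> h1 h2; apply: le_trans (ler_norm _); rewrite invr1 mulr1 in h2.
lra.
Qed.

(** Shared by the rows from the second on: [r] stands for rho^(i/2) and [c] for a sum of inverse
    i-th powers. After multiplying by [r], the worst case is r/20 + 3r^2/2 at 0.779, about 0.95. *)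
Lemma inv_sub_mul_ge (R : realType) (r c : R) :
  0 < r -> r < 779%:R / 1000%:R -> c <= 3%:R / 2%:R ->
  1 / 20%:R + r * c <= r^-1.
Proof.
move=> r0 r1 c1; rewrite -(ler_pM2r r0) mulVf ?lt0r_neq0 //.
have : r * c * r <= r * (3%:R / 2%:R) * r by rewrite ler_pM2r // ler_pM2l.
nra.
Qed.

Lemma coef_row2_dominant (R : realType) (rho : R) (N : nat) :
  0 < rho -> rho < 779%:R / 1000%:R -> (1 < N)%N ->
  1 / 20%:R + \sum_(0 <= j < N | j != 1%N) `|coef rho 2 j.+1|
    <= `|coef rho 2 2|.
Proof.
move=> r0 r1 N1.
have E : rho `^ (2 / 2) = rho by rewrite divff // powRr1 // ltW.
(* The term j = 2 must be left out here: the full sum of inverse squares tends to pi^2/6, above 3/2.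
   The diagonal allows this because its correction is positive for i = 2. *)
have hs : \sum_(0 <= j < N | j != 1%N) `|coef rho 2 j.+1|
    <= rho * (1 + 2%:R^-1).
  under eq_bigr do rewrite norm_coef_offdiag //.
  rewrite E.
  rewrite -mulr_sumr ler_pM2l // big_mkcond big_ltn; last by apply: ltn_trans N1.
  rewrite big_ltn //= add0r expr1n invr1 lerD2l.
  apply: le_trans (sum_inv_sq_le R N (isT : 0 < 2)%N); apply: ler_sum => j _.
  by case: ifP => // _; rewrite invr_ge0 exprn_ge0.
have -> : coef rho 2 2 = rho^-1 + rho / 4%:R.
  by rewrite /coef /= powRN E expr2 mulrNN !mul1r -natrX.
have := inv_sub_mul_ge (c := 3%:R / 2%:R) r0 r1 (lexx _).
move=> h; apply: le_trans (ler_norm _); lra.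
Qed.

Lemma coef_rows_ge3_dominant (R : realType) (rho : R) (i N : nat) :
  0 < rho -> rho < 779%:R / 1000%:R -> (2 <= i)%N -> (i < N)%N ->
  1 / 20%:R + \sum_(0 <= j < N | j != i) `|coef rho i.+1 j.+1|
    <= `|coef rho i.+1 i.+1|.
Proof.
move=> r0 r1 i2 iN; have r1' : rho <= 1 by lra.
have /andP[p0 p1] := @sqrt_pow_bounds R rho i.+1 r0 r1' (ltnW i2).
set r := rho `^ _ in p0 p1 *.
(* Whatever the parity, the diagonal correction costs at most the term j = i absent from the
   off-diagonal sum, so the full sum over [j] is what has to be bounded. *)
have hd : r^-1 - r * (i.+1%:R ^+ i.+1)^-1 <= `|coef rho i.+1 i.+1|.
  rewrite /coef /= eqSS gtn_eqF ?(ltnW i2) // eqxx powRN -/r.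
  apply: le_trans (lerB_normD _ _); rewrite normrM normrX normrN1 expr1n mul1r.
  have q0 : 0 <= (i.+1%:R ^+ i.+1)^-1 :> R by rewrite invr_ge0 exprn_ge0.
  rewrite (ger0_norm (x := r^-1)) ?invr_ge0; last by lra.
  by rewrite ger0_norm // mulr_ge0 //; lra.
(* For exponents at least 3 and j at least 2, j^(-i) is at most j^(-2)/2, which gives 1 + 1/2. *)
have hs : \sum_(0 <= j < N) (j.+1%:R ^+ i.+1)^-1 <= 3%:R / 2%:R :> R.
  rewrite big_ltn ?(leq_ltn_trans _ iN) // expr1n invr1.
  suff : \sum_(1 <= j < N) (j.+1%:R ^+ i.+1)^-1 <= 2%:R^-1 * 1%:R^-1 :> R by lra.
  apply: le_trans (_ : 2%:R^-1 * \sum_(1 <= j < N) (j.+1%:R ^+ 2)^-1 <= _);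
    last by rewrite ler_pM2l ?invr_gt0 //; exact: sum_inv_sq_le.
  rewrite mulr_sumr big_seq_cond [leRHS]big_seq_cond; apply: ler_sum => j.
  rewrite mem_index_iota => /andP[/andP[j1 _] _].
  have j2 : 2 <= j.+1%:R :> R by rewrite ler_nat.
  have j0 : 0 < j.+1%:R ^+ 2 :> R by rewrite exprn_gt0.
  rewrite -invfM lef_pV2 ?posrE ?mulr_gt0 ?exprn_gt0 //.
  apply: le_trans (_ : j.+1%:R ^+ 3 <= _); last by rewrite ler_eXn2l // ltr1n.
  by rewrite [leRHS]exprS ler_pM2r.
have hr := le_lt_trans p1 r1.
have := inv_sub_mul_ge p0 hr hs.
have iin : i \in index_iota 0 N by rewrite mem_index_iota.
rewrite (bigD1_seq i) ?iota_uniq //= mulrDr => h.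
have -> : \sum_(0 <= j < N | j != i) `|coef rho i.+1 j.+1| =
    r * \sum_(0 <= j < N | j != i) (j.+1%:R ^+ i.+1)^-1.
  by rewrite mulr_sumr; apply: eq_bigr => j ji; rewrite norm_coef_offdiag // ltnW.
lra.
Qed.

(** * Application of the abstract result with margin 1/20 and tails 1/m *)

Theorem mainTheorem2 (R : realType) (rho : R)
    (rho_gt0 : 0 < rho) (rho_lt : rho < 779%:R / 1000%:R) :
  exists x : nat -> R,
    [/\ bounded_solution rho x,
        forall y : nat -> R, bounded_solution rho y -> y = x,
        forall N : nat, (1 <= N)%N ->
          exists! v : 'cV[R]_N, truncated_solution rho v
      & forall xN : (forall N : nat, 'cV[R]_N),
          (forall N : nat, (1 <= N)%N -> truncated_solution rho (xN N)) ->
          forall k : nat,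
            cauchy (component xN k @ \oo) /\ component xN k @ \oo --> x k].
Proof.
have rho_le1 : rho <= 1 by lra.
pose a i j := coef rho i.+1 j.+1.
have d0 : 0 < 1 / 20%:R :> R by lra.
have dom : uniformly_dominant a (1 / 20%:R).
  move=> [|[|i]] N iN; first exact: coef_row1_dominant.
    exact: coef_row2_dominant.
  exact: coef_rows_ge3_dominant.
have t0 : (fun m => m%:R^-1 : R) @ \oo --> (0 : R).
  by rewrite -(cvg_shiftS (fun m => m%:R^-1 : R)); exact: cvg_harmonic.
have [x [[M xM] x_sol x_uniq x_lim]] := dominant_system d0 dom
  (coef_tails rho_gt0 rho_le1) t0 (fun i => norm_rhs_le1 i rho_gt0 rho_le1).
exists x; split.
- split=> //; exists M; split; first exact: num_real.
  by move=> K MK j _ /=; apply: le_trans (xM j) (ltW MK).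
(* [bounded_fun] gives a bound only for numbers strictly above [K], hence [K + 1]. *)
- move=> y [[K [_ hK]] ys]; apply: (x_uniq y (K + 1)) => // j.
  by apply: (hK (K + 1)) => //=; rewrite ltrDl.
- move=> N _; have uA := dominant_unitmx N d0 dom.
  exists (invmx (\matrix_(i < N, j < N) a i j) *m \col_(i < N) rhs rho i.+1).
  split; first by rewrite /truncated_solution mulKVmx.
  by move=> v; rewrite /truncated_solution => <-; rewrite mulKmx.
move=> xN hxN k.
have lim_k : component xN k @ \oo --> x k.
  have := x_lim (fun N => extend_by_zero (xN N)) _ k.
  move=> /(_ (fun N N0 => (truncated_mxP a _ _).1 (hxN N N0))).
  (* Term [n] of [component] comes from the truncation of size [n + k.+1], so it is a shift of the
     sequence indexed by [N]. *)
  rewrite -(cvg_shiftn k.+1) /=.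
  suff -> : component xN k = fun n => extend_by_zero (xN (n + k.+1)%N) k by [].
  apply/funext => n; rewrite (_ : (n + k.+1 = k + n.+1)%N); last first.
    by rewrite addnC addSnnS.
  have := extend_by_zeroE (xN (k + n.+1)%N) (rshift k ord0).
  by rewrite /= addn0.
split=> //; apply: cvg_cauchy; apply/cvg_ex; exists (x k); exact: lim_k.
Qed.
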